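(* Let $n,k$ be positive integers with $k<\frac n2$, and let $H$ be a subgroup of $S_n$. Suppose that $\rho$ is a linear character of $H$ such that for every subset $T\in\mathbb{Z}_n^{(k)}$ the restriction of $\rho$ to $H\cap S_{n,T}$ is not the trivial character of $H\cap S_{n,T}$. Then for any $(n,k)$-wreath $\mathcal{F}$, the vector $\sum_{h\in H}\rho(h)\,e_{h\mathcal{F}}$ lies in the kernel of the $(n,k)$-wreath matrix $M$.
   Context: $\mathbb{Z}_n$ is the set of integers modulo $n$, $\mathbb{Z}_n^{(k)}$ is the set of its $k$-element subsets, and $S_n$ is the group of permutations of $\mathbb{Z}_n$. For $\pi\in S_n$, let $\mathcal{F}_\pi=\{\{\pi((i-1)k+1),\ldots,\pi(ik)\} : i\in\mathbb{Z}_n\}\subset\mathbb{Z}_n^{(k)}$ (arguments modulo $n$). An $(n,k)$-wreath is a family of the form $\mathcal{F}_\pi$; $\mathcal{W}_{n,k}$ is the set of all of them. $S_n$ acts on $\mathcal{W}_{n,k}$ by $\tau\mathcal{F}_\pi=\mathcal{F}_{\tau\pi}$ (equivalently, by applying $\tau$ to every set of the wreath). The $(n,k)$-wreath matrix $M$ has rows and columns labelled by $\mathcal{W}_{n,k}$ and entries $M_{\mathcal{F},\mathcal{F}'}=|\mathcal{F}\cap\mathcal{F}'|$. It acts on the complex vector space $V$ with basis $\{e_{\mathcal{F}}:\mathcal{F}\in\mathcal{W}_{n,k}\}$. A linear character of a group $H$ is a homomorphism $\rho:H\to\mathbb{C}^\times$; the trivial character sends every element to $1$. For $T\in\mathbb{Z}_n^{(k)}$,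 $S_{n,T}=\{\pi\in S_n:\pi(T)=T\}$. *)

(* Defs.v *)
From HB Require Import structures.
From mathcomp Require Import all_boot all_order all_algebra all_fingroup.
From mathcomp Require Import reals.
From mathcomp.real_closed Require Import complex.

Set Implicit Arguments.
Unset Strict Implicit.
Unset Printing Implicit Defensive.

Import GRing.Theory.
Local Open Scope ring_scope.

(* 'Z_n is the ring of integers modulo n only when 1 < n; for n < 2 it denotes
   Z/2Z, so these definitions are meant for 1 < n. *)

Definition wreath_block (n k : nat) (pi : {perm 'Z_n}) (i : 'Z_n) :
    {set 'Z_n} :=
  [set pi ((i - 1) * k%:R + j.+1%:R) | j : 'I_k].

Definition wreath_family (n k : nat) (pi : {perm 'Z_n}) : {set {set 'Z_n}} :=
  [set wreath_block k pi i | i : 'Z_n].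

Definition wreaths (n k : nat) : {set {set {set 'Z_n}}} :=
  [set wreath_family k pi | pi : {perm 'Z_n}].

Definition wreath (n k : nat) : Type :=
  {F : {set {set 'Z_n}} | F \in wreaths n k}.

Definition family_act (n : nat) (tau : {perm 'Z_n}) (F : {set {set 'Z_n}}) :
    {set {set 'Z_n}} :=
  [set tau @: A | A : {set 'Z_n} in F].

(* Products of permutations are read from left to right: (pi * tau)%g is the
   composite tau o pi. *)
Lemma family_act_wreath (n k : nat) (tau pi : {perm 'Z_n}) :
  family_act tau (wreath_family k pi) = wreath_family k (pi * tau)%g.
Proof.
rewrite /family_act /wreath_family -imset_comp; apply: eq_imset => i /=.
rewrite /wreath_block -imset_comp; apply: eq_imset => j /=.
by rewrite permM.
Qed.

Lemma family_act_closed (n k : nat) (tau : {perm 'Z_n}) (F : wreath n k) :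
  family_act tau (val F) \in wreaths n k.
Proof.
by case: F => _ /= /imsetP[pi _ ->]; rewrite family_act_wreath imset_f.
Qed.

Definition wreath_act (n k : nat) (tau : {perm 'Z_n}) (F : wreath n k) :
    wreath n k :=
  exist _ (family_act tau (val F)) (family_act_closed tau F).

(* Vectors and matrices indexed by wreaths use the enumeration of the finite
   type wreath n k. *)
Definition wreath_mx (R : realType) (n k : nat) : 'M[R[i]]_#|{: wreath n k}| :=
  \matrix_(a, b) #|val (enum_val a) :&: val (enum_val b)|%:R.

Definition wreath_vec (R : realType) (n k : nat) (F : wreath n k) :
    'cV[R[i]]_#|{: wreath n k}| :=
  delta_mx (enum_rank F) 0.

(* A homomorphism from H to the multiplicative group of R[i], given by a
   function whose values outside H are irrelevant; the target being
   commutative, the order of composition in H does not matter. *)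
Definition linear_character (R : realType) (gT : finGroupType) (H : {group gT})
    (rho : gT -> R[i]) : Prop :=
  {in H, forall h, rho h != 0} /\
  {in H &, forall g h, rho (g * h)%g = rho g * rho h}.

Definition trivial_on (R : realType) (gT : finGroupType) (A : {set gT})
    (rho : gT -> R[i]) : Prop :=
  {in A, forall h, rho h = 1}.

Definition set_stabilizer (n : nat) (T : {set 'Z_n}) : {set {perm 'Z_n}} :=
  [set s : {perm 'Z_n} | s @: T == T].

(* Main.v *)
Require Import Defs.
From HB Require Import structures.
From mathcomp Require Import all_boot all_order all_algebra all_fingroup.
From mathcomp Require Import reals.
From mathcomp.real_closed Require Import complex.

Set Implicit Arguments.
Unset Strict Implicit.
Unset Printing Implicit Defensive.

Import GRing.Theory.
Local Open Scope ring_scope.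

(** The entry of the product at a wreath [G] is the sum over [h] in [H] of
    [rho h] times the number of [T] in [G] that belong to [h F].  Exchanging the
    two sums, it is enough to show, for each [k]-element set [T], that the sum of
    [rho h] over those [h] in [H] with [T] in [h F] vanishes.  Membership of [T] in [h F]
    is unchanged when [h] is followed by an element [s] of [H] that stabilizes
    [T], so this sum is multiplied by [rho s] under the reindexing that takes [h]
    to [h] followed by [s]; the hypothesis on [rho] provides such an [s] with
    [rho s != 1], which forces the sum to be zero
    ([weighted_character_sum_eq0], [family_act_stabilized]).  That the blocks
    of a wreath do have [k] elements is [card_wreath_block], which rests on
    [k <= n]. *)

(** Reindexing by [h |-> h * s] multiplies the sum by [rho s]. *)
Lemma weighted_character_sum_eq0 (R : realType) (gT : finGroupType)
    (H : {group gT}) (rho f : gT -> R[i]) (s : gT) :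
  linear_character H rho -> s \in H -> rho s != 1 ->
  {in H, forall h, f (h * s)%g = f h} ->
  \sum_(h in H) rho h * f h = 0.
Proof.
move=> [_ rhoM] Hs rho_s f_inv; set S := \sum_(h in H) _.
have fixS : S = rho s * S.
  rewrite {1}/S (reindex_inj (mulIg s)) mulr_sumr /=.
  under eq_bigl => h do rewrite groupMr //.
  by apply: eq_bigr => h Hh; rewrite rhoM // f_inv // mulrA [rho s * _]mulrC.
have /eqP : (1 - rho s) * S = 0 by rewrite mulrBl mul1r -fixS subrr.
by rewrite mulf_eq0 subr_eq0 eq_sym (negPf rho_s) /= => /eqP.
Qed.

Lemma nontrivial_on_witness (R : realType) (gT : finGroupType) (A : {set gT})
    (rho : gT -> R[i]) :
  ~ trivial_on A rho -> exists2 s, s \in A & rho s != 1.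
Proof.
move=> ntriv; apply/exists_inP; apply/contraT; rewrite negb_exists_in.
move=> /forall_inP rho1; case: ntriv => h Ah.
by apply/eqP/negPn; apply: rho1.
Qed.

Lemma natr_Zp_inj (n : nat) : (1 < n)%N ->
  {in gtn n &, injective (fun j : nat => j%:R : 'Z_n)}.
Proof.
move=> n_gt1 j l; rewrite !inE => lt_jn lt_ln /(congr1 val).
by rewrite /= !val_Zp_nat // !modn_small.
Qed.

Lemma card_wreath_block (n k : nat) (pi : {perm 'Z_n}) (i : 'Z_n) :
  (1 < n)%N -> (k <= n)%N -> #|wreath_block k pi i| = k.
Proof.
move=> n_gt1 le_kn; rewrite card_imset ?card_ord // => j l /perm_inj/addrI.
rewrite -!natr1 => /addIr eq_jl; apply: val_inj.
by apply: (natr_Zp_inj n_gt1) eq_jl; apply: leq_trans le_kn; apply: ltn_ord.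
Qed.

Lemma card_wreath_member (n k : nat) (F : wreath n k) (T : {set 'Z_n}) :
  (1 < n)%N -> (k <= n)%N -> T \in val F -> #|T| = k.
Proof.
move=> n_gt1 le_kn; case: F => _ /= /imsetP[pi _ ->] /imsetP[i _ ->].
exact: card_wreath_block.
Qed.

Lemma family_actM (n : nat) (h s : {perm 'Z_n}) (F : {set {set 'Z_n}}) :
  family_act (h * s)%g F = family_act s (family_act h F).
Proof.
rewrite /family_act -imset_comp; apply: eq_imset => A /=.
by rewrite -imset_comp; apply: eq_imset => x /=; rewrite permM.
Qed.

(** Since [T] is its own image under [s] and taking images under [s] is
    injective on sets, [T] is in [s (h F)] exactly when it is in [h F]. *)
Lemma family_act_stabilized (n : nat) (h s : {perm 'Z_n})
    (F : {set {set 'Z_n}}) (T : {set 'Z_n}) :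
  s \in set_stabilizer T ->
  (T \in family_act (h * s)%g F) = (T \in family_act h F).
Proof.
rewrite inE family_actM => /eqP sT; rewrite -{1}sT.
exact/mem_imset/imset_inj/perm_inj.
Qed.

Lemma wreath_mx_vecE (R : realType) (n k : nat) (F : wreath n k)
    (a : 'I_#|{: wreath n k}|) (b : 'I_1) :
  (wreath_mx R n k *m wreath_vec R F) a b
    = \sum_(T in val (enum_val a)) (T \in val F)%:R.
Proof.
rewrite (ord1 b) -colE !mxE enum_rankK -sum1_card natr_sum.
rewrite big_mkcond [RHS]big_mkcond; apply: eq_bigr => T _.
by rewrite inE; case: (T \in val (enum_val a)); case: (T \in val F).
Qed.

Theorem lemma5p2 (R : realType) (n k : nat) (n_gt0 : (0 < n)%N)
    (k_gt0 : (0 < k)%N) (k_lt_half : (2 * k < n)%N)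
    (H : {group {perm 'Z_n}}) (rho : {perm 'Z_n} -> R[i])
    (rho_char : linear_character H rho)
    (rho_nontrivial : forall T : {set 'Z_n}, #|T| = k ->
       ~ trivial_on (H :&: set_stabilizer T) rho)
    (F : wreath n k) :
  wreath_mx R n k *m (\sum_(h in H) rho h *: wreath_vec R (wreath_act h F)) = 0.
Proof.
have n_gt1 : (1 < n)%N.
  by apply: leq_ltn_trans k_lt_half; rewrite mul2n -addnn ltn_addr.
have le_kn : (k <= n)%N.
  by apply: leq_trans (ltnW k_lt_half); rewrite leq_pmull.
apply/matrixP => a b; rewrite mulmx_sumr summxE [RHS]mxE.
transitivity (\sum_(T in val (enum_val a))
    \sum_(h in H) rho h * (T \in family_act h (val F))%:R).
  rewrite exchange_big /=; apply: eq_bigr => h _.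
  by rewrite -scalemxAr mxE wreath_mx_vecE mulr_sumr.
apply: big1 => T GT; have cardT := card_wreath_member n_gt1 le_kn GT.
have [s /setIP[Hs sT] rho_s] := nontrivial_on_witness (rho_nontrivial T cardT).
apply: (weighted_character_sum_eq0 rho_char Hs rho_s) => h _.
by rewrite family_act_stabilized.
Qed.
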